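(* Consider a training set of $N$ vectors with $d$ attributes each and $M$ classes, and let $h$ be the height of the decision tree to be constructed. The running time of the Quantum C5.0 algorithm (QC5.0, described in the context) is $$O\big((h\sqrt{d}\,N\log N)\log d\big).$$ The success probability of QC5.0 is $$O\Big(\big(1-\tfrac1d\big)^k\Big),$$ where $k$ is the number of inner nodes (not leaves) of the tree.
   Context: Classification data. The input is a training set $\mathcal X=\{X^1,\dots,X^N\}$ with classes $y_1,\dots,y_N\in\{1,\dots,M\}$, where $X^i=(x^i_1,\dots,x^i_d)$. Each attribute $j\in\{1,\dots,d\}$ is either real-valued or discrete-valued with values in $\{1,\dots,T_j\}$. Cost model. Query model: the algorithm queries a black box that has access to the training data and stored data; running time is the number of queries. Quantum query algorithms are used as subroutines and the rest is classical. Splitting criterion. For a set $\mathcal X'$ of training vectors let $RF(j;\mathcal X')$ be the relative frequency of class $j$ in $\mathcal X'$, and $I(\mathcal X')=-\sum_{j=1}^M RF(j;\mathcal X')\log RF(j;\mathcal X')$. If a test $B$ splits $\mathcal X'$ into $\mathcal X_1,\dots,\mathcal X_t$, put $G(\mathcal X',B)=I(\mathcal X')-\sum_{i=1}^t\frac{|\mathcal X_i|}{|\mathcal X'|}I(\mathcal X_i)$ and $P(\mathcal X',B)=-\sum_{i=1}^t\frac{|\mathcal X_i|}{|\mathcal X'|}\log\frac{|\mathcal X_i|}{|\mathcal X'|}$. The gain ratio of $B$ is $G(\mathcal X',B)/P(\mathcal X',B)$. Tree construction. A binary tree of height $h$ is assumed to be constructed, where $h$ is a parameter of the algorithm. A recursive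 procedure FormTree is called on $\mathcal X$ at the root. If all vectors of the current set $\mathcal X'$ belong to one class, the result is a leaf labelled by that class. Otherwise FormTree chooses an attribute and a split by this attribute that maximize the gain ratio, splits $\mathcal X'$, and calls itself on each part. Processing one attribute (ProcessAttribute) for a set $\mathcal X'$, $z=|\mathcal X'|$. - Real-valued attribute $a$: sort $\mathcal X'$ by $x_a$, obtaining the order $i_1,\dots,i_z$. Compute, in passes through this order and with incremental updates, the class counters $pC_j[u]=|\{w\le u: y_{i_w}=j\}|$, the values $pI[u]=I(\{X^{i_1},\dots,X^{i_u}\})$ and $pbI[u]=I(\{X^{i_u},\dots,X^{i_z}\})$. Take the maximum over $u\in\{1,\dots,z-1\}$ of the gain ratio of the split into $\{X^{i_1},\dots,X^{i_u}\}$ and $\{X^{i_{u+1}},\dots,X^{i_z}\}$ (threshold $\theta_u=(x_a^{i_u}+x_a^{i_{u+1}})/2$). - Discrete-valued attribute $a$: the split is by the value of the attribute, $\mathcal X_w=\{i: X^i\in\mathcal X',\ x_a^i=w\}$ for $w\in\{1,\dots,T_a\}$. The vectors are processed one by one, maintaining the variables $N_w$ (number of elements of $\mathcal X_w$), $C_j$ (number of vectors of $\mathcal X'$ in class $j$), $C_{j,w}$ (number of vectors of $\mathcal X_w$ in class $j$), $P$ (potential information), $I_w$ (for $I(\mathcal X_w)$), $I$ (for $I(\mathcal X')$) and $S$ (for $G(\mathcal X',B)-I(\mathcal X')$). Writing primes for the values before processing a vector of class $j$ with attribute value $w$, the updates are: $N_w\gets N_w'+1$; $C_j\gets C_j'+1$;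 $C_{j,w}\gets C_{j,w}'+1$; $P\gets P'-\big(-\frac{N'_w}{z}\log\frac{N'_w}{z}+\frac{N_w}{z}\log\frac{N_w}{z}\big)$; $I_w\gets I_w'-\big(-\frac{C_{j,w}'}{N_w'}\log\frac{C_{j,w}'}{N_w'}+\frac{C_{j,w}}{N_w}\log\frac{C_{j,w}}{N_w}\big)$; $I\gets I'-\big(-\frac{C_j'}{z}\log\frac{C_j'}{z}+\frac{C_j}{z}\log\frac{C_j}{z}\big)$; $S\gets S'-\big(-\frac{N_w'}{z}\log\frac{N_w'}{z}+\frac{N_w'}{z}\log\frac{N_w'}{z}\big)$. The counters $pC_j[u]$ and $C_{j,w}$ are kept in a Tree Map, i.e. a self-balancing binary search tree (AVL or red-black) containing only the indexes with non-zero value (all other values being zero): adding, removing, finding and modifying an entry takes $O(\log s)$, and removing or checking all entries takes $O(s)$, where $s$ is the number of stored indexes. The entries are erased after an attribute has been processed. The running time of ProcessAttribute is taken to be $O(|\mathcal X'|\log|\mathcal X'|)$. QC5.0. This is the construction above in which, at each inner node, the maximum over the $d$ attributes is found by quantum maximum search, with ProcessAttribute as the function to be maximized. The search is the Dürr–Høyer algorithm with Grover's search replaced by amplitude amplification: for $f:\{1,\dots,K\}\to\mathbb R$ computable in running time $T(K)$, it finds an argument of the maximum in expected running time $O(\sqrt K\cdot T(K))$ with success probability at least $\frac12$. To reduce the error probability the search is repeated $\log d$ times and the best solution is used. Success of QC5.0 refers to finding the correct attributes for all nodes except leaves.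
   Formalization: The success probability is shown to be at least (1-1/d)^k; the literal upper bound O((1-1/d)^k) fails, e.g. when all attributes coincide. ProcessAttribute returns the true maximal gain ratio, not the result of the misprinted updates of S and I_w. Running time is expected queries. *)

(* Defs.v *)
From Stdlib Require List.
From HB Require Import structures.
From mathcomp Require Import all_boot all_order all_algebra.
From mathcomp Require Import all_classical all_reals all_analysis.
From mathcomp Require Import giry.

Set Implicit Arguments.
Unset Strict Implicit.
Unset Printing Implicit Defensive.

Import Order.TTheory GRing.Theory Num.Theory.
Import numFieldNormedType.Exports.

Local Open Scope classical_set_scope.
Local Open Scope ring_scope.

(** A computation is a law on pairs (result, number of queries).  The
    sigma-algebra is the discrete one, so every map is measurable and the Giry
    monad of the library can be used without side conditions.  [bind] draws
    the second computation independently of the first one, given its result,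
    and adds the numbers of queries.  A quantum subroutine ends with a
    measurement and enters through the law of what it returns. *)

Definition discrete (T : Type) : Type := T.

HB.instance Definition _ (T : pointedType) := Pointed.on (discrete T).
HB.instance Definition _ (T : pointedType) :=
  @isMeasurable.Build default_measure_display (discrete T)
    discrete_measurable discrete_measurable0
    discrete_measurableC discrete_measurableU.

HB.instance Definition _ (T : choiceType) := isPointed.Build (seq T) [::].

Lemma measurable_discrete (T : pointedType) d (U : measurableType d)
  (f : discrete T -> U) : measurable_fun [set: discrete T] f.
Proof. by []. Qed.

Definition computation (R : realType) (A : pointedType) : Type :=
  giry (discrete (A * nat)%type) R.

Section Computations.
Context {R : realType}.

Definition ret (A : pointedType) (a : A) : computation R A :=
  giry_ret ((a, 0%N) : discrete (A * nat)%type).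

Definition tick (n : nat) : computation R unit :=
  giry_ret ((tt, n) : discrete (unit * nat)%type).

Definition add_cost (A : pointedType) (n : nat)
    (r : discrete (A * nat)%type) : discrete (A * nat)%type :=
  (r.1, (n + r.2)%N).

Definition bind (A B : pointedType) (m : computation R A) (f : A -> computation R B) :
    computation R B :=
  giry_bind m (@measurable_discrete _ _ (computation R B)
    (fun r => giry_map (@measurable_discrete _ _ _ (@add_cost B r.2)) (f r.1))).

Fixpoint run_all (A : pointedType) (cs : seq (computation R A)) : computation R (seq A) :=
  if cs is c :: cs' then
    bind c (fun a => bind (run_all cs') (fun s => ret (a :: s)))
  else ret [::].

Definition expected_cost (A : pointedType) (c : computation R A) : \bar R :=
  (\int[c]_r (r.2%:R : R)%:E)%E.

Definition prob (A : pointedType) (c : computation R A) (E : set A) : \bar R :=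
  c [set r | E r.1].

End Computations.

(** The search is a black box: it receives the function [f] to be maximized
    together with the running times [t] of its evaluations, and every run
    terminates almost surely ([probability]).  It may return no argument. *)

Definition max_search (R : realType) : Type :=
  forall K : nat, ('I_K -> R) -> ('I_K -> nat) ->
    probability (discrete (option 'I_K * nat)%type) R.

Definition is_argmax (R : realType) (K : nat) (f : 'I_K -> R) (j : 'I_K) :
  Prop := forall i, f i <= f j.

Definition durr_hoyer_guarantee (R : realType) (qmax : max_search R) : Prop :=
  exists c : R, forall (K : nat) (f : 'I_K -> R) (t : 'I_K -> nat) (T : nat),
    (0 < K)%N -> (0 < T)%N -> (forall j, (t j <= T)%N) ->
    (expected_cost (qmax K f t : computation R _) <=
       (c * (Num.sqrt K%:R * T%:R))%:E)%E /\
    ((2^-1 : R)%:E <=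
       prob (qmax K f t : computation R _)
         [set r | exists2 j, r = Some j & is_argmax f j])%E.

Inductive attr_kind := RealAttr | DiscreteAttr of nat.

Definition attr_val (R : realType) (a : attr_kind) : Type :=
  match a with RealAttr => R | DiscreteAttr T => 'I_T end.

Record training_set (R : realType) (N d M : nat) := TrainingSet {
  kind : 'I_d -> attr_kind;
  attr : forall j : 'I_d, 'I_N -> attr_val R (kind j);
  cls : 'I_N -> 'I_M
}.

Inductive test (R : realType) := Threshold of R | ByValue.

Inductive dtree (R : realType) (d M : nat) :=
  | Leaf of option 'I_M
  | Node of 'I_d & test R & seq (dtree R d M).

Arguments ByValue {R}.
Arguments Leaf {R d M}.

HB.instance Definition _ (R : realType) (d M : nat) :=
  gen_eqMixin (dtree R d M).
HB.instance Definition _ (R : realType) (d M : nat) :=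
  gen_choiceMixin (dtree R d M).
HB.instance Definition _ (R : realType) (d M : nat) :=
  isPointed.Build (dtree R d M) (Leaf None).

Fixpoint inner_nodes (R : realType) (d M : nat) (t : dtree R d M) : nat :=
  match t with
  | Leaf _ => 0
  | Node _ _ ts => (sumn [seq inner_nodes t' | t' <- ts]).+1
  end.

(** The conventions [ln 0 = 0] and [x / 0 = 0] make the terms of empty classes
    and of empty parts vanish, and give gain ratio 0 to a split with zero
    potential information (a single nonempty part). *)

Section Criterion.
Context {R : realType} {N d M : nat}.
Variable D : training_set R N d M.
Implicit Types (X : {set 'I_N}) (parts : seq {set 'I_N}) (j : 'I_d).

Definition class_count X (c : 'I_M) : nat := #|[set i in X | cls D i == c]|.

Definition rel_freq X (c : 'I_M) : R := (class_count X c)%:R / #|X|%:R.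

Definition info X : R := - \sum_(c < M) rel_freq X c * ln (rel_freq X c).

Definition weight X (Y : {set 'I_N}) : R := #|Y|%:R / #|X|%:R.

Definition gain X parts : R :=
  info X - \sum_(Y <- parts) weight X Y * info Y.

Definition potential X parts : R :=
  - \sum_(Y <- parts) weight X Y * ln (weight X Y).

Definition gain_ratio X parts : R := gain X parts / potential X parts.

Definition sorted_by (x : 'I_N -> R) X : seq 'I_N :=
  sort (fun i i' => x i <= x i') (enum X).

Definition cut (s : seq 'I_N) (u : nat) : seq {set 'I_N} :=
  [:: [set i in take u s]; [set i in drop u s]].

Definition threshold (x : 'I_N -> R) (s : seq 'I_N) (u : nat) : R :=
  let xs := [seq x i | i <- s] in (nth 0 xs u.-1 + nth 0 xs u) / 2.

(** The position of the first maximum of the gain ratio over the positions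
    1, ..., |X| - 1. *)
Definition best_cut X (s : seq 'I_N) : nat :=
  foldl (fun v u => if gain_ratio X (cut s v) < gain_ratio X (cut s u)
                    then u else v)
        1%N (iota 1 #|X|.-1).

(** The best split by attribute [j]: the test stored in the node and the parts
    into which it divides [X].  The gain ratio of this split is the value that
    ProcessAttribute returns. *)
Definition best_split X j : test R * seq {set 'I_N} :=
  match kind D j as a return ('I_N -> attr_val R a) -> _ with
  | RealAttr => fun x =>
      let s := sorted_by x X in
      let u := best_cut X s in (Threshold (threshold x s u), cut s u)
  | DiscreteAttr T => fun x =>
      (ByValue, [seq [set i in X | x i == w] | w <- enum 'I_T])
  end (attr D j).

Definition attr_value X j : R := gain_ratio X (best_split X j).2.

Definition pure X : bool :=
  [forall i in X, forall i' in X, cls D i == cls D i'].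

(** A most frequent class; the common class when [X] is pure and nonempty. *)
Definition leaf_class X : option 'I_M :=
  [pick c | [forall c', class_count X c' <= class_count X c]%N].

End Criterion.

(** Running time of ProcessAttribute on a set of vectors and an attribute. *)
Definition process_time (R : realType) : Type :=
  forall N d M : nat, training_set R N d M -> {set 'I_N} -> 'I_d -> nat.

(** The constant depends neither on the data nor on [d] and [M].  Sets with
    one vector, for which the bound would be 0, are never processed. *)
Definition process_time_bound (R : realType) (pt : process_time R) : Prop :=
  exists c : R, forall (N d M : nat) (D : training_set R N d M)
      (X : {set 'I_N}) (j : 'I_d), (1 < #|X|)%N ->
    (pt N d M D X j)%:R <= c * (#|X|%:R * ln #|X|%:R).

Section QC50.
Context {R : realType}.
Variables (qmax : max_search R) (pt : process_time R).
Context {N d M : nat}.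
Variable D : training_set R N d M.
Implicit Types (X : {set 'I_N}).

Definition better (f : 'I_d -> R) (r r' : option 'I_d) : option 'I_d :=
  match r, r' with
  | Some j, Some j' => if f j < f j' then r' else r
  | Some _, None => r
  | None, _ => r'
  end.

(** [n] independent runs of the search; the value of each returned attribute
    is recomputed, by one more call of ProcessAttribute, for the comparison. *)
Fixpoint best_of (n : nat) X : computation R (option 'I_d) :=
  if n is n'.+1 then
    bind (qmax (attr_value D X) (pt D X) : computation R _) (fun r =>
    bind (tick (if r is Some j then pt D X j else 0%N)) (fun _ =>
    bind (best_of n' X) (fun r' => ret (better (attr_value D X) r r'))))
  else ret None.

(** [log d] repetitions: the least [n] with [d <= 2 ^ n]. *)
Definition repetitions : nat := up_log 2 d.

(** [h] bounds the height of the tree still to be built.  The class check and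
    the division of [X] into parts read one datum per vector.  If none of the
    runs returns an attribute, the node remains a leaf (and the construction
    fails, see [correct_tree]). *)
Fixpoint form_tree (h : nat) X : computation R (dtree R d M) :=
  bind (tick #|X|) (fun _ =>
    if pure D X then ret (Leaf (leaf_class D X)) else
    if h is h'.+1 then
      bind (best_of repetitions X) (fun r =>
        if r is Some j then
          let: (b, parts) := best_split D X j in
          bind (tick #|X|) (fun _ =>
          bind (run_all [seq form_tree h' Y | Y <- parts]) (fun ts =>
          ret (Node j b ts)))
        else ret (Leaf (leaf_class D X)))
    else ret (Leaf (leaf_class D X))).

Definition QC50 (h : nat) : computation R (dtree R d M) := form_tree h [set: 'I_N].

End QC50.

(** The trees in which the attribute of every inner node maximizes the gain
    ratio; there can be several of them when the maximum is not unique. *)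
Fixpoint correct_tree (R : realType) (N d M : nat) (D : training_set R N d M)
    (h : nat) (X : {set 'I_N}) (t : dtree R d M) : Prop :=
  if pure D X then t = Leaf (leaf_class D X) else
  if h is h'.+1 then
    if t is Node j b ts then
      [/\ is_argmax (attr_value D X) j,
          b = (best_split D X j).1 &
          List.Forall2 (correct_tree D h') (best_split D X j).2 ts]
    else False
  else t = Leaf (leaf_class D X).

(* Main.v *)
(** Cost: the parts of a split have total size at most that of the set which
    is split, so all calls of FormTree on one level of the tree together cost
    at most a constant times [sqrt d * N * ln N * ln d], and there are at most
    [h + 1] levels.

    Success: the best of several searches fails to maximize only if every
    search does, so [n] repetitions fail with probability at most [2^-n], and
    [2^-n <= 1/d] for [n = up_log 2 d].  The choices at different nodes are independent, hence induction
    on the height gives a correct tree [t] with success probability at least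
    [(1 - 1/d)^(inner_nodes t)].  When several attributes maximize the gain
    ratio, [t] is built on the one with the largest subtrees, which is the
    worst case. *)

Require Import Defs.
From mathcomp Require Import all_boot all_order all_algebra.
From mathcomp Require Import all_classical all_reals all_analysis.
From mathcomp Require Import giry zify ring lra.
Import Order.TTheory GRing.Theory Num.Theory.
Local Open Scope classical_set_scope.
Local Open Scope ring_scope.

Set Implicit Arguments.
Unset Strict Implicit.
Unset Printing Implicit Defensive.

(* [/=] would otherwise unfold these to the underlying pushforwards. *)
#[local] Arguments prob : simpl never.
#[local] Arguments expected_cost : simpl never.
#[local] Arguments bind : simpl never.

(** * Expected cost and probability of sequenced computations *)

Section Computations.
Context {R : realType}.

Lemma integral_bind (A B : pointedType) (m : computation R A)
    (f : A -> computation R B) (g : discrete (B * nat)%type -> \bar R) :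
  (forall r, 0 <= g r)%E ->
  (\int[bind m f]_r g r =
   \int[m]_r \int[f r.1]_s g (add_cost r.2 s))%E.
Proof.
move=> g0; rewrite -[LHS]/(giry_int (bind m f) g) /bind giry_int_bind//.
by apply: eq_integral => r _; rewrite giry_int_map.
Qed.

Lemma integral_ret (A : pointedType) (a : A)
    (g : discrete (A * nat)%type -> \bar R) :
  (\int[ret a : computation R A]_r g r = g (a, 0%N))%E.
Proof. exact: giry_int_ret. Qed.

Lemma integral_tick n (g : discrete (unit * nat)%type -> \bar R) :
  (\int[tick n : computation R unit]_r g r = g (tt, n))%E.
Proof. exact: giry_int_ret. Qed.

Lemma prob_integral (A : pointedType) (m : computation R A) (E : set A) :
  (prob m E = \int[m]_r (\1_[set r | E r.1] r)%:E)%E.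
Proof. by rewrite integral_indic// setIT. Qed.

Lemma expected_cost_ge0 (A : pointedType) (m : computation R A) :
  (0 <= expected_cost m)%E.
Proof. by apply: integral_ge0 => r _; rewrite lee_fin. Qed.

Lemma expected_cost_ret (A : pointedType) (a : A) :
  expected_cost (ret a : computation R A) = 0%E.
Proof. exact: integral_ret. Qed.

Lemma expected_cost_tick n : expected_cost (tick n : computation R unit) = n%:R%:E.
Proof. exact: integral_tick. Qed.

(** A law of type [giry] is only a subprobability, hence an inequality. *)
Lemma integral_cst_le (A : pointedType) (m : computation R A) (K : \bar R) :
  (0 <= K)%E -> (\int[m]_r K <= K)%E.
Proof.
move=> K0; rewrite integral_cst//= -[leRHS]mule1 lee_pmul//.
exact: sprobability_setT.
Qed.

Lemma expected_cost_bind_le (A B : pointedType) (m : computation R A)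
    (f : A -> computation R B) (K L : \bar R) :
  (expected_cost m <= K)%E -> (forall a, expected_cost (f a) <= L)%E ->
  (expected_cost (bind m f) <= K + L)%E.
Proof.
move=> mK fL; apply: le_trans (leeD2r L mK).
(* The sign of [L] is read off at [point], an element of [A]. *)
have L0 : (0 <= L)%E by apply: le_trans (fL point); exact: expected_cost_ge0.
rewrite /expected_cost integral_bind; last by move=> r; rewrite lee_fin.
apply: (@le_trans _ _ (\int[m]_r ((r.2%:R : R)%:E + L))%E); last first.
  rewrite ge0_integralD//; first by rewrite leeD2l// integral_cst_le.
apply: ge0_le_integral => //.
  by move=> r _; apply: integral_ge0 => s _; rewrite lee_fin.
move=> r _.
under eq_integral do rewrite /= natrD EFinD.
rewrite ge0_integralD//.
by apply: leeD; [exact: integral_cst_le | exact: fL].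
Qed.

Lemma expected_cost_bind_ret (A B : pointedType) (m : computation R A) (g : A -> B) :
  expected_cost (bind m (fun a => ret (g a))) = expected_cost m.
Proof.
rewrite /expected_cost integral_bind; last by move=> r; rewrite lee_fin.
by apply: eq_integral => r _; rewrite integral_ret /= addn0.
Qed.

Lemma expected_cost_bind_tick_le (A : pointedType) n (f : unit -> computation R A) K :
  (expected_cost (f tt) <= K)%E ->
  (expected_cost (bind (tick n) f) <= n%:R%:E + K)%E.
Proof.
move=> fK; apply: expected_cost_bind_le => [|[]//].
by rewrite expected_cost_tick.
Qed.

Lemma prob_bind (A B : pointedType) (m : computation R A)
    (f : A -> computation R B) (E : set B) :
  prob (bind m f) E = (\int[m]_r prob (f r.1) E)%E.
Proof.
rewrite prob_integral integral_bind; last by move=> r; rewrite lee_fin.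
by apply: eq_integral => r _; rewrite prob_integral.
Qed.

Lemma prob_ret (A : pointedType) (a : A) (E : set A) :
  E a -> prob (ret a : computation R A) E = 1%E.
Proof. by move=> Ea; rewrite prob_integral integral_ret indicE mem_set. Qed.

Lemma prob_bind_ret (A B : pointedType) (m : computation R A) (g : A -> B)
    (E : set B) :
  prob (bind m (fun a => ret (g a))) E = prob m (g @^-1` E).
Proof.
rewrite prob_bind prob_integral; apply: eq_integral => r _.
by rewrite prob_integral integral_ret.
Qed.

Lemma prob_bind_tick (A : pointedType) n (f : unit -> computation R A) (E : set A) :
  prob (bind (tick n) f) E = prob (f tt) E.
Proof. by rewrite prob_bind integral_tick. Qed.

Lemma prob_le (A : pointedType) (m : computation R A) (E F : set A) :
  E `<=` F -> (prob m E <= prob m F)%E.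
Proof. by move=> EF; apply: le_measure; rewrite ?inE//; move=> r /EF. Qed.

(** The probability of [E] after the first result is at least [q] times the indicator of [S];
    integrate over that result. *)
Lemma prob_bind_ge (A B : pointedType) (m : computation R A)
    (f : A -> computation R B) (S : set A) (E : set B) (p q : R) :
  0 <= q -> (p%:E <= prob m S)%E -> (forall a, S a -> (q%:E <= prob (f a) E)%E) ->
  ((p * q)%:E <= prob (bind m f) E)%E.
Proof.
move=> q0 mp fq; rewrite mulrC EFinM; apply: le_trans (lee_wpmul2l _ mp) _ => //.
rewrite prob_bind prob_integral -ge0_integralZl//.
apply: ge0_le_integral => //.
  by move=> r _; rewrite mule_ge0// lee_fin.
move=> r _; rewrite indicE; case: (boolP (_ \in _)) => [|_]; last by rewrite mule0.
by rewrite inE mule1 => /fq.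
Qed.

Lemma prob_bind_le (A B : pointedType) (m : computation R A)
    (f : A -> computation R B) (S : set A) (E : set B) (p q : R) :
  0 <= q -> (prob m S <= p%:E)%E -> (forall a, S a -> (prob (f a) E <= q%:E)%E) ->
  (forall a, ~ S a -> prob (f a) E = 0%E) ->
  (prob (bind m f) E <= (p * q)%:E)%E.
Proof.
move=> q0 mp fq f0; rewrite mulrC EFinM; apply: le_trans (lee_wpmul2l _ mp) => //.
rewrite prob_bind prob_integral -ge0_integralZl//.
apply: ge0_le_integral => //.
move=> r _; rewrite indicE; case: (boolP (_ \in _)) => [|/negP]; rewrite inE.
  by rewrite mule1 => /fq.
by rewrite mule0 => /f0 ->.
Qed.

End Computations.

(** * Lists of independent computations *)

Section RunAll.
Context {R : realType}.

Lemma expected_cost_run_all (A : pointedType) (cs : seq (computation R A)) :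
  (expected_cost (run_all cs) <= \sum_(c <- cs) expected_cost c)%E.
Proof.
elim: cs => [|c cs IH]; first by rewrite big_nil /= expected_cost_ret.
rewrite big_cons /=; apply: expected_cost_bind_le => // a.
by rewrite expected_cost_bind_ret.
Qed.

(** Independent runs multiply the lower bounds, so the exponents of [p] add up. The witnesses are
    collected along with the bound because the exponent depends on them. *)
Lemma prob_run_all (A : pointedType) (B : Type) (w : A -> nat) (p : R)
    (F : B -> computation R A) (P : B -> A -> Prop) (Ys : seq B) :
  0 <= p ->
  (forall Y, exists2 t, P Y t & ((p ^+ w t)%:E <= prob (F Y) (P Y))%E) ->
  exists ts, List.Forall2 P Ys ts /\
    ((p ^+ sumn [seq w t | t <- ts])%:E <=
       prob (run_all [seq F Y | Y <- Ys]) (List.Forall2 P Ys))%E.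
Proof.
move=> p0 HF; elim: Ys => [|Y Ys [ts [Pts Hts]]].
  by exists [::]; rewrite prob_ret//; exact: List.Forall2_nil.
have [t Pt Ht] := HF Y.
exists (t :: ts); split; first exact: List.Forall2_cons.
rewrite /= exprD; apply: prob_bind_ge Ht _; first by rewrite exprn_ge0.
move=> a Pa; rewrite prob_bind_ret; apply: le_trans Hts _.
by apply: prob_le => s Ps; exact: List.Forall2_cons.
Qed.

End RunAll.

(** The parts come from cutting a duplicate-free list in two or are the fibres of a discrete
    attribute. Costs linear in the set sizes thus do not grow from level to level. *)
Lemma sum_card_best_split {R : realType} {N d M : nat} (D : training_set R N d M)
    (X : {set 'I_N}) (j : 'I_d) :
  (\sum_(Y <- (best_split D X j).2) #|Y| = #|X|)%N.
Proof.
rewrite /best_split; case: (kind D j) (attr D j) => [|T] x /=.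
  set s := sorted_by x X; set u := best_cut _ _ _.
  have us : uniq s by rewrite sort_uniq enum_uniq.
  rewrite !big_cons big_nil addn0 !cardsE.
  rewrite (card_uniqP (take_uniq _ us)) (card_uniqP (drop_uniq _ us)).
  by rewrite -size_cat cat_take_drop size_sort cardE.
rewrite big_map big_enum/=.
rewrite -sum1_card (partition_big x predT)//=.
apply: eq_bigr => w _; rewrite -sum1_card; apply: eq_bigl => i.
by rewrite inE.
Qed.

(** * Failure probability of repeated searches *)

Section Search.
Context {R : realType} {N d M : nat}.
Variables (qmax : max_search R) (pt : process_time R) (D : training_set R N d M).
Implicit Types X : {set 'I_N}.

(** Each search terminates almost surely; this total mass is what allows passing to complements. *)
Lemma prob_best_of_setT n X : prob (best_of qmax pt D n X) setT = 1%E.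
Proof.
elim: n => [|n IH]; first exact: prob_ret.
rewrite /= prob_bind.
under eq_integral do rewrite prob_bind_tick prob_bind_ret preimage_setT IH.
rewrite integral_cst//= mul1e; exact: probability_setT.
Qed.

Lemma prob_best_of_fail n X : (0 < d)%N -> durr_hoyer_guarantee qmax ->
  (prob (best_of qmax pt D n X)
     (~` [set r | exists2 j, r = Some j & is_argmax (attr_value D X) j]) <=
     ((2^-1) ^+ n)%:E)%E.
Proof.
move=> d0 [c Hc]; set S := [set r | _].
elim: n => [|n IH].
  by rewrite expr0 -(prob_best_of_setT 0 X) prob_le.
rewrite exprS /=; apply: (@prob_bind_le _ _ _ _ _ (~` S)).
- by rewrite exprn_ge0// invr_ge0.
- have [T ptT] : exists T, forall j, (pt D X j <= T)%N.
    by exists (\max_j pt D X j)%N => j; exact: leq_bigmax.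
  (* The guarantee asks for a positive time bound, hence [T.+1]. *)
  have [|_ half] := Hc d (attr_value D X) (pt D X) T.+1 d0 isT.
    by move=> j; exact: leqW.
  set search : computation R _ := qmax _ _ in half *.
  have -> : prob search (~` S) = (1 - prob search S)%E by exact: probability_setC.
  have -> : 2^-1 = 1 - 2^-1 :> R by lra.
  by rewrite EFinB leeB.
(* If [r'] holds a maximizer, so does [better]: it drops [r'] only for an attribute of at least the
   same value. Overall failure therefore forces the later runs to fail. *)
- move=> r Sr; rewrite prob_bind_tick prob_bind_ret.
  apply: le_trans IH; apply: prob_le => r' /= Sr' r'S; apply: Sr'.
  case: r'S Sr => j' -> j'max; case: r => [j|] /=; last by exists j'.
  case: ltP => [|jj'] _; first by exists j'.
  by exists j => // i; exact: le_trans (j'max i) jj'.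
(* The strict comparison in [better] always keeps a maximizer [j], so failure is impossible. *)
- move=> r /contrapT[j -> jmax]; rewrite prob_bind_tick prob_bind_ret.
  rewrite (_ : _ @^-1` _ = set0) ?measure0//.
  apply/seteqP; split => // r' /= nS; apply: nS.
  case: r' => [j'|] /=; last by exists j.
  by rewrite ltNge jmax /=; exists j.
Qed.

End Search.

(** * Expected cost of building the tree *)

Section Cost.
Context {R : realType} {N d M : nat}.
Variables (qmax : max_search R) (pt : process_time R) (D : training_set R N d M).
Implicit Types X : {set 'I_N}.

Lemma expected_cost_best_of (q : R) (T n : nat) X :
  (expected_cost (qmax (attr_value D X) (pt D X) : computation R _) <= q%:E)%E ->
  (forall j, (pt D X j <= T)%N) ->
  (expected_cost (best_of qmax pt D n X) <= (n%:R * (q + T%:R))%:E)%E.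
Proof.
move=> costq ptT; elim: n => [|n IH].
  by rewrite mul0r /= expected_cost_ret.
rewrite /= (_ : n.+1%:R * _ = q + (T%:R + n%:R * (q + T%:R)) :> R); last first.
  by rewrite -natr1; ring.
rewrite !EFinD; apply: expected_cost_bind_le => // r.
apply: le_trans (expected_cost_bind_tick_le _ _) _.
  by rewrite expected_cost_bind_ret; exact: IH.
by apply: leeD2r; rewrite lee_fin ler_nat; case: r => [j|].
Qed.

(** [B] bounds the work at one inner node per vector; linearity in [#|Y|] makes the bounds of the
    children add up to that of the parent. *)
Lemma expected_cost_form_tree (B : R) h X :
  1 <= B ->
  (forall Y, ~~ pure D Y ->
     (#|Y|%:R%:E + (expected_cost (best_of qmax pt D (@repetitions d) Y) + #|Y|%:R%:E) <=
      (B * #|Y|%:R)%:E)%E) ->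
  (expected_cost (form_tree qmax pt D h X) <= (h.+1%:R * (B * #|X|%:R))%:E)%E.
Proof.
move=> B1 HB; have B0 : 0 <= B by apply: le_trans B1.
have leaf (X' : {set 'I_N}) h' (o : option 'I_M) :
    (expected_cost (bind (tick #|X'|) (fun _ => ret (Leaf o)) : computation R (dtree R d M))
     <= (h'.+1%:R * (B * #|X'|%:R))%:E)%E.
  rewrite expected_cost_bind_ret expected_cost_tick lee_fin mulrA ler_peMl//.
  by rewrite -[leLHS]mulr1 ler_pM// ler1n.
elim: h X => [|h IH] X /=; first by case: ifP => _; exact: leaf.
case: ifPn => pX; first exact: leaf.
(* One of the [h.+2] shares of [B * #|X|] pays for the node, the other [h.+1] for its subtrees. *)
rewrite -natr1 mulrDl mul1r addrC EFinD.
apply: (le_trans _ (leeD2r _ (HB X pX))).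
rewrite -addeA; apply: expected_cost_bind_tick_le; rewrite -addeA.
apply: expected_cost_bind_le; first exact: lexx.
move=> -[j|]; last first.
  by rewrite expected_cost_ret -EFinD lee_fin addr_ge0// !mulr_ge0.
case E : best_split => [b parts].
apply: expected_cost_bind_tick_le.
rewrite expected_cost_bind_ret; apply: le_trans (expected_cost_run_all _) _.
rewrite big_map -(sum_card_best_split D X j) E/=.
rewrite natr_sum !mulr_sumr -sumEFin.
exact: lee_sum.
Qed.

End Cost.

(** * Success probability of the tree construction *)

Section Success.
Context {R : realType} {N d M : nat}.
Variables (qmax : max_search R) (pt : process_time R) (D : training_set R N d M).
Implicit Types X : {set 'I_N}.

Lemma exists_argmax (f : 'I_d -> R) : (0 < d)%N -> exists j, is_argmax f j.
Proof.
case: d f => // d' f _.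
by case: (@arg_maxP _ _ _ ord0 xpredT f isT) => j _ jmax; exists j => i; exact: jmax.
Qed.

Lemma prob_best_of X : (0 < d)%N -> durr_hoyer_guarantee qmax ->
  ((1 - d%:R^-1)%:E <= prob (best_of qmax pt D (@repetitions d) X)
     [set r | exists2 j, r = Some j & is_argmax (attr_value D X) j])%E.
Proof.
move=> d0 Hq.
have := prob_best_of_fail pt D (@repetitions d) X d0 Hq; set S := [set r | _] => fail.
have := prob_best_of_setT qmax pt D (@repetitions d) X.
rewrite -(setUv S) /prob [X in best_of _ _ _ _ _ X](_ : _ =
  [set r | S r.1] `|` [set r | (~` S) r.1])//.
rewrite measureU//; last by apply/seteqP; split => // r [].
rewrite -/(prob _ S) -/(prob _ (~` S)) => mass.
rewrite EFinB leeBlDr//; rewrite -mass leeD2l//.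
apply: le_trans fail _; rewrite lee_fin exprVn lef_pV2 ?posrE ?exprn_gt0 ?ltr0n//.
rewrite -natrX ler_nat.
by rewrite /repetitions; exact: up_logP.
Qed.

Lemma prob_form_tree h X : (0 < d)%N -> durr_hoyer_guarantee qmax ->
  exists2 t, correct_tree D h X t &
    (((1 - d%:R^-1) ^+ inner_nodes t)%:E <=
       prob (form_tree qmax pt D h X) (correct_tree D h X))%E.
Proof.
move=> d0 Hq; set p := 1 - _.
have p0 : 0 <= p by rewrite subr_ge0 invf_le1 ?ltr0n// ler1n.
have p1 : p <= 1 by rewrite lerBlDr lerDl invr_ge0.
elim: h X => [|h IH] X /=.
  exists (Leaf (leaf_class D X)); first by case: ifP.
  by rewrite prob_bind_tick; case: ifP => _; rewrite prob_ret.
rewrite prob_bind_tick; case: ifPn => pX.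
  by exists (Leaf (leaf_class D X)); rewrite ?prob_ret.
(* For each attribute [j], choice fixes witnesses [ts j] for the parts of its split. *)
have /choice[ts Hts] := fun j => prob_run_all (best_split D X j).2 p0 IH.
pose s j := sumn [seq inner_nodes t | t <- ts j].
have [j0 j0max] := exists_argmax (attr_value D X) d0.
(* Any maximizer [i] may be returned. Taking [j] with the largest [s j] gives [p ^+ s j <= p ^+ s i]
   for all of them, as [p <= 1]. *)
have [j /asboolP jmax js] :=
  @arg_maxnP _ j0 (fun j => `[< is_argmax (attr_value D X) j >]) s (asboolT j0max).
exists (Node j (best_split D X j).1 (ts j)).
  by split => //; have [] := Hts j.
rewrite [inner_nodes _]/= exprS.
apply: prob_bind_ge (prob_best_of X d0 Hq) _; first by rewrite exprn_ge0.
move=> _ [i -> imax].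
have := Hts i; case E : best_split => [b parts] /= [_ Hi].
rewrite prob_bind_tick prob_bind_ret.
apply: (@le_trans _ _ (p ^+ s i)%:E).
  by rewrite lee_fin ler_wiXn2l//; apply: js; exact/asboolP.
apply: le_trans Hi _; apply: prob_le => us Pus /=.
by rewrite E; split.
Qed.

End Success.

(** * Numerical bounds and the final estimate *)

Lemma card_not_pure {R : realType} {N d M : nat} (D : training_set R N d M)
    (X : {set 'I_N}) : ~~ pure D X -> (1 < #|X|)%N.
Proof.
apply: contraNT; rewrite -leqNgt => /card_le1_eqP X1.
apply/forall_inP => i iX; apply/forall_inP => i' i'X.
by rewrite (X1 i i').
Qed.

(** Rounding the binary logarithm up adds at most 1, which is itself at most that logarithm when [d]
    is at least 2; hence the factor 2. *)
Lemma natr_repetitions_le {R : realType} (d : nat) : (1 < d)%N ->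
  (@repetitions d)%:R <= 2 * (ln 2)^-1 * ln d%:R :> R.
Proof.
move=> d1; have ln2 : 0 < ln 2 :> R by rewrite ln_gt0// ltr1n.
have /andP[le_d _] := up_log_bounds (isT : (1 < 2)%N) d1.
rewrite /repetitions; set k := up_log 2 d in le_d *.
have k1 : k.-1%:R * ln 2 <= ln d%:R :> R.
  rewrite mulr_natl -lnXn// -natrX ler_ln ?posrE ?ltr0n ?expn_gt0//.
    by rewrite ler_nat ltnW.
  exact: ltn_trans d1.
have ln2d : ln 2 <= ln d%:R :> R by rewrite ler_ln ?posrE ?ltr0n ?ler_nat// ltnW.
have kS : k%:R <= k.-1%:R + 1 :> R by rewrite natr1 ler_nat leqSpred.
rewrite mulrAC ler_pdivlMr//.
apply: le_trans (ler_wpM2r (ltW ln2) kS) _; rewrite mulrDl mul1r; lra.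
Qed.

(** Success is bounded from below; ties can lead to correct trees of different sizes, so [k] bounds
    them all. The cost bound starts at [N = d = 2] because the logarithms vanish at 1. *)
Theorem theorem2 (R : realType) (qmax : max_search R) (pt : process_time R)
    (Hqmax : durr_hoyer_guarantee qmax) (Hpt : process_time_bound pt) :
  (exists C : R, forall (N d M h : nat) (D : training_set R N d M),
     (1 < N)%N -> (1 < d)%N -> (0 < h)%N ->
     (expected_cost (QC50 qmax pt D h) <=
        (C * (h%:R * Num.sqrt d%:R * N%:R * ln N%:R * ln d%:R))%:E)%E) /\
  (forall (N d M h k : nat) (D : training_set R N d M),
     (0 < d)%N ->
     (forall t, correct_tree D h [set: 'I_N]%SET t -> (inner_nodes t <= k)%N) ->
     (((1 - d%:R^-1) ^+ k)%:E <=
        prob (QC50 qmax pt D h) [set t | correct_tree D h [set: 'I_N]%SET t])%E).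
Proof.
split; last first.
  move=> N d M h k D d0 Hk.
  have [t t_ok Ht] := prob_form_tree pt D h [set: 'I_N]%SET d0 Hqmax.
  apply: le_trans Ht; rewrite lee_fin ler_wiXn2l ?Hk//.
  by rewrite subr_ge0 invf_le1 ?ltr0n// ler1n.
have [c0 Hc0] := Hqmax; have [b0 Hb0] := Hpt.
(* The given constants may be negative; truncation at 0 keeps the products monotone. *)
pose c := Num.max c0 0; pose b := Num.max b0 0; pose e : R := (ln 2)^-1.
have c_ge0 : 0 <= c by rewrite le_max lexx orbT.
have b_ge0 : 0 <= b by rewrite le_max lexx orbT.
have ln2 : 0 < ln 2 :> R by rewrite ln_gt0// ltr1n.
have e_gt0 : 0 < e by rewrite invr_gt0.
(* Hence additive constants and the rounding of [log d] are absorbed by the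
   factors [ln N] and [ln d]. *)
have e_ln n : (1 < n)%N -> 1 <= e * ln n%:R.
  move=> n1; rewrite mulrC ler_pdivlMr// mul1r ler_ln ?posrE ?ltr0n ?ler_nat//.
  exact: ltnW.
(* The first summand pays for class check and division. In the second, [2 * e] comes from the
   repetitions, [c + 1] from a search with one recomputation, [b + e] from the time of
   ProcessAttribute. *)
pose C0 := 2 * e * e + 2 * e * (c + 1) * (b + e).
(* The factor 2 absorbs [h + 1 <= 2 * h]. *)
exists (2 * C0) => N d M h D N1 d1 h0.
have d0 : (0 < d)%N by exact: ltnW.
set sd := Num.sqrt d%:R; set lN := ln N%:R; set ld := ln d%:R.
have sd1 : 1 <= sd by rewrite -sqrtr1 ler_sqrt// ler1n.
have lN1 : 1 <= e * lN by exact: e_ln.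
have ld1 : 1 <= e * ld by exact: e_ln.
have lN0 : 0 < lN by rewrite ln_gt0// ltr1n.
have ld0 : 0 < ld by rewrite ln_gt0// ltr1n.
(* The bound is strict to make [T] positive; the extra 1 is covered by [e * lN * #|X|%:R]. *)
have time (X : {set 'I_N}) : ~~ pure D X ->
    exists2 T : nat, (forall j, pt N d M D X j < T)%N & T%:R <= (b + e) * lN * #|X|%:R.
  move=> /card_not_pure X1.
  exists (\max_j pt N d M D X j).+1 => [j|].
    by rewrite ltnS; exact: (leq_bigmax j).
  have [|j ->] := @bigop.eq_bigmax _ (pt N d M D X); first by rewrite card_ord.
  have X0 : 1 <= #|X|%:R :> R by rewrite ler1n ltnW.
  have lX : ln #|X|%:R <= lN.
    rewrite ler_ln ?posrE ?ltr0n ?(ltnW X1) ?(ltnW N1)// ler_nat.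
    by rewrite -[leqRHS]card_ord max_card.
  have lX0 : 0 <= ln #|X|%:R :> R by rewrite ln_ge0.
  rewrite -natr1 -mulrA mulrDl; apply: lerD.
    apply: le_trans (Hb0 N d M D X j X1) _.
    apply: (@le_trans _ _ (b * (#|X|%:R * ln #|X|%:R))).
      by rewrite ler_wpM2r ?mulr_ge0// le_max lexx.
    by rewrite ler_wpM2l// [leRHS]mulrC ler_wpM2l.
  by rewrite mulrA mulr_ege1.
pose n := @repetitions d.
pose B := C0 * (sd * lN * ld).
have n_le : n%:R <= 2 * e * ld by exact: natr_repetitions_le.
have V0 : 0 <= (c + 1) * sd * ((b + e) * lN).
  by rewrite !(mulr_ge0, addr_ge0)// ltW// (lt_le_trans _ sd1).
have B2 : 2 + n%:R * ((c + 1) * sd * ((b + e) * lN)) <= B.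
  rewrite /B /C0 [leRHS]mulrDl; apply: lerD.
    have -> : 2 * e * e * (sd * lN * ld) = 2 * (sd * (e * lN) * (e * ld)) by ring.
    by rewrite ler_peMr// mulr_ege1// mulr_ege1.
  have -> : 2 * e * (c + 1) * (b + e) * (sd * lN * ld) =
    2 * e * ld * ((c + 1) * sd * ((b + e) * lN)) by ring.
  exact: ler_wpM2r.
have B1 : 1 <= B.
  by apply: le_trans B2; have := mulr_ge0 (ler0n R n) V0; lra.
apply: le_trans (expected_cost_form_tree (B := B) h _ B1 _) _.
  move=> Y npY; have [T ptT Tle] := time Y npY.
  have T0 : (0 < T)%N by apply: leq_ltn_trans (ptT (Ordinal d0)).
  have [cost _] := Hc0 d (attr_value D Y) (pt N d M D Y) T d0 T0 (fun j => ltnW (ptT j)).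
  have {}ptT j := ltnW (ptT j).
  apply: le_trans (leeD2l _ (leeD2r _ (expected_cost_best_of n cost ptT))) _.
  rewrite -!EFinD lee_fin.
  apply: le_trans (ler_wpM2r _ B2) => //.
  (* The recomputation costs at most [T <= sd * T], since [1 <= sd]. *)
  have cT : c0 * (sd * T%:R) + T%:R <= (c + 1) * sd * ((b + e) * lN * #|Y|%:R).
    have sd0 : 0 <= sd by apply: le_trans sd1.
    apply: (@le_trans _ _ ((c + 1) * sd * T%:R)); last first.
      by rewrite ler_wpM2l// mulr_ge0// addr_ge0.
    rewrite -mulrA mulrDl mul1r lerD//; last by rewrite ler_peMl.
    by rewrite ler_wpM2r ?mulr_ge0// le_max lexx.
  have -> : (2 + n%:R * ((c + 1) * sd * ((b + e) * lN))) * #|Y|%:R =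
    #|Y|%:R + (n%:R * ((c + 1) * sd * ((b + e) * lN * #|Y|%:R)) + #|Y|%:R) by ring.
  by rewrite lerD2l lerD2r; exact: ler_wpM2l.
rewrite lee_fin cardsT card_ord.
have -> : 2 * C0 * (h%:R * sd * N%:R * lN * ld) = (2 * h%:R) * (B * N%:R).
  by rewrite /B; ring.
rewrite ler_wpM2r//; first by rewrite mulr_ge0// (le_trans _ B1).
by rewrite -natrM ler_nat; lia.
Qed.
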